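(* Let $n,k,\ell$ be positive integers with $n>k\ell$, and suppose that $\mathcal{F}\subseteq[n]^{(k)}$ and $\mathcal{G}\subseteq[n]^{(\ell)}$ are cross-intersecting. Then there is some $i\in[n]$ such that $\vert\partial(\mathcal{F}(i))\vert\geq\vert\mathcal{F}(i)\vert$ or $\vert\partial(\mathcal{G}(i))\vert\geq\vert\mathcal{G}(i)\vert$.
   Context: $[n]=\{1,\dots,n\}$ and $X^{(k)}$ denotes the set of $k$-element subsets of $X$. Families $\mathcal{F},\mathcal{G}$ are cross-intersecting if $F\cap G\neq\emptyset$ for every $F\in\mathcal{F}$, $G\in\mathcal{G}$. The shadow of a family $\mathcal{H}$ is $\partial\mathcal{H}=\{H\setminus\{x\}: x\in H\in\mathcal{H}\}$. For $i\in[n]$, the link is $\mathcal{F}(i)=\{F\setminus\{i\}: i\in F\in\mathcal{F}\}$ (similarly for $\mathcal{G}$). *)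

(* Defs.v *)
From mathcomp Require Import all_boot.

Set Implicit Arguments.
Unset Strict Implicit.
Unset Printing Implicit Defensive.

Definition ksubsets (T : finType) (k : nat) : {set {set T}} :=
  [set A : {set T} | #|A| == k].

Definition cross_intersecting (T : finType) (F G : {set {set T}}) : Prop :=
  forall A B : {set T}, A \in F -> B \in G -> A :&: B != set0.

Definition shadow (T : finType) (H : {set {set T}}) : {set {set T}} :=
  [set A :\ x | A in H, x in A].

Definition link (T : finType) (F : {set {set T}}) (i : T) : {set {set T}} :=
  [set A :\ i | A in F & i \in A].

(* Main.v *)
(** Call a family fat if it has more members than its shadow.  Two
    cross-intersecting families are never both fat: compressions preserve
    cross-intersection and sizes and do not enlarge shadows, and once the first
    family is shifted, one of the two contains no ballot set; deleting from each set the
    step at which its walk first peaks then embeds that family in its shadow.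

    For a set [U] of vertices let [fat U F] consist of the [E] disjoint from [U]
    such that [{C \subset U : C :|: E \in F}] is fat.  By the above, [fat U F] and
    [fat U G] cross-intersect.  Moreover, if [U \subset V], every member of
    [fat V F] extends to a member of [fat U F] by elements of [V :\: U].  If all
    links are fat, then [fat U F] and [fat U G] cover the complement of [U].
    Adding to [U] a member of [fat U G] costs at most [l] vertices and lowers the
    largest size in [fat U F] by one, so after [k] steps [fat U F] contains only
    the empty set although [U] is not everything: a contradiction. *)

Require Import Defs.
From mathcomp Require Import all_boot.
From mathcomp Require Import fingroup perm zify.

Set Implicit Arguments.
Unset Strict Implicit.
Unset Printing Implicit Defensive.

Lemma shadowP (T : finType) (H : {set {set T}}) (B : {set T}) :
  reflect (exists2 x, x \notin B & x |: B \in H) (B \in shadow H).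
Proof.
apply: (iffP imset2P) => [[A x AH xA ->]|[x xB xBH]].
  by exists x; [rewrite setD11 | rewrite setD1K].
by exists (x |: B) x; rewrite ?setU11 // setU1K.
Qed.

(** * Compressions *)

Section Shift.

Variables (n : nat) (i j : 'I_n).
Implicit Types (A B : {set 'I_n}) (X Y : {set {set 'I_n}}).

Definition swap_set B : {set 'I_n} := [set x | tperm i j x \in B].

Lemma swap_setK : involutive swap_set.
Proof. by move=> B; apply/setP=> x; rewrite !inE tpermK. Qed.

Lemma swap_setU1 x B : swap_set (x |: B) = tperm i j x |: swap_set B.
Proof.
apply/setP=> y; rewrite !inE; congr (_ || _).
by rewrite -(inj_eq (@perm_inj _ (tperm i j))) tpermK.
Qed.

Lemma swap_set_id B : (i \in B) = (j \in B) -> swap_set B = B.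
Proof. by move=> ij; apply/setP=> x; rewrite inE; case: tpermP => // ->. Qed.

Lemma swap_set_move B :
  j \in B -> i \notin B -> swap_set B = i |: (B :\ j).
Proof.
move=> jB iB; rewrite -{1}(setD1K jB) swap_setU1 tpermR swap_set_id //.
by rewrite !inE eqxx (negbTE iB) andbF.
Qed.

Lemma swap_set_disjoint A B : A :&: B = set0 -> swap_set A :&: swap_set B = set0.
Proof.
move=> AB0; apply/setP=> x; rewrite !inE.
by move/setP/(_ (tperm i j x)): AB0; rewrite !inE.
Qed.

(* The usual compression of [j] to [i]: when [i] and [j] both belong or both
   do not belong to [B], [swap_set B = B] and this reduces to [B \in X]. *)
Definition shift X : {set {set 'I_n}} :=
  [set B : {set 'I_n} | if i \in B then (B \in X) || (swap_set B \in X)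
           else (B \in X) && (swap_set B \in X)].

Definition shift_set X B :=
  if (i \notin B) && (swap_set B \notin X) then swap_set B else B.

Lemma shift_imset X : shift X = shift_set X @: X.
Proof.
apply/setP=> B; rewrite inE; apply/idP/imsetP; last first.
  case=> A AX ->; rewrite /shift_set.
  case: (boolP ((i \notin A) && _)) => [/andP[iA sAX]|].
    have jA : j \in A.
      apply: contraR sAX => jA; rewrite swap_set_id //.
      by rewrite (negbTE iA) (negbTE jA).
    by rewrite inE tpermL jA swap_setK AX orbT.
  by case: (i \in A); rewrite AX //= negbK.
case: ifP => iB; last first.
  by case/andP=> BX sBX; exists B => //; rewrite /shift_set sBX andbF.
have [BX _|BX /= sBX] := boolP (B \in X).
  by exists B => //; rewrite /shift_set iB.
exists (swap_set B) => //; rewrite /shift_set swap_setK BX andbT inE tpermL.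
case: ifP => // /negbT; rewrite negbK => jB.
by rewrite swap_set_id ?iB ?jB.
Qed.

Lemma shift_set_inj X : {in X &, injective (shift_set X)}.
Proof.
move=> A B AX BX; rewrite /shift_set.
case: ifP => [/andP[_ sA]|_]; case: ifP => [/andP[_ sB]|_] //.
- exact: (can_inj swap_setK).
- by move=> E; rewrite E BX in sA.
- by move=> E; rewrite -E AX in sB.
Qed.

Lemma card_shift X : #|shift X| = #|X|.
Proof. by rewrite shift_imset card_in_imset //; apply: shift_set_inj. Qed.

Lemma shadow_shift X : shadow (shift X) \subset shift (shadow X).
Proof.
have shS x B : x \notin B -> x |: B \in X -> B \in shadow X.
  by move=> xB AX; apply/shadowP; exists x.
have shW x B : x \notin B -> swap_set (x |: B) \in X -> swap_set B \in shadow X.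
  by move=> xB; rewrite swap_setU1; apply: shS; rewrite inE tpermK.
apply/subsetP=> B /shadowP[x xB]; rewrite !inE => AS.
case: ifP => iB.
  move: AS; rewrite iB orbT => /orP[AX|AX]; apply/orP; first by left; apply: shS xB AX.
  by right; apply: shW xB AX.
(* When [x = i], [x |: B] gives only a disjunction while [B] needs both memberships; if [j] is in
   [B] then [swap_set] fixes [x |: B], otherwise it fixes [B]. *)
move: AS; rewrite iB orbF; case: eqP => [Ei|_] /=; last first.
  by case/andP=> AX sAX; rewrite (shS _ _ xB AX) (shW _ _ xB sAX).
have [jB|jB] := boolP (j \in B).
  rewrite (@swap_set_id (x |: B)) ?orbb; last by rewrite !inE -Ei eqxx jB orbT.
  move=> AX; rewrite (shS _ _ xB AX) /=; apply: (shW _ _ xB).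
  by rewrite swap_set_id // !inE -Ei eqxx jB orbT.
have sB : swap_set B = B by rewrite swap_set_id // iB (negbTE jB).
rewrite sB andbb => /orP[AX|sAX]; first exact: shS AX.
by rewrite -sB; apply: shW xB sAX.
Qed.

(** Disjoint [A] and [B] cannot both contain [i], so one of them meets both conditions of [shift].
    Hence [A] and [B], or their swaps, lie in [X] and [Y], and swapping preserves disjointness. *)
Lemma shift_cross X Y :
  cross_intersecting X Y -> cross_intersecting (shift X) (shift Y).
Proof.
move=> cXY A B; rewrite !inE => AS BS; apply/negP=> /eqP AB0.
have noXY : A \in X -> B \in Y -> False.
  by move=> AX BY; move: (cXY _ _ AX BY); rewrite AB0 eqxx.
have noS : swap_set A \in X -> swap_set B \in Y -> False.
  by move=> AX BY; move: (cXY _ _ AX BY); rewrite swap_set_disjoint ?eqxx.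
move: AS BS; case: ifP => iA; case: ifP => iB.
- by move/setP/(_ i): AB0; rewrite !inE iA iB.
- by case/orP=> AX /andP[BY sBY]; [apply: noXY | apply: noS].
- by case/andP=> AX sAX /orP[BY|BY]; [apply: noXY | apply: noS].
- by case/andP=> AX _ /andP[BY _]; apply: noXY.
Qed.

Definition weight X := \sum_(A in X) \sum_(x in A) (x : nat).

(** Termwise along [shift_set]: a moved member trades [j] for the smaller [i], and equality means
    that nothing moves. *)
Lemma weight_shift X : i < j ->
  weight (shift X) <= weight X ?= iff
    [forall (A : {set 'I_n} | A \in X), (i \notin A) ==> (swap_set A \in X)].
Proof.
move=> ltij; rewrite /weight shift_imset big_imset; last exact: shift_set_inj.
apply: leqif_sum => A AX; rewrite /shift_set.
case: (boolP (i \in A)) => //= iA; first exact/leqif_refl.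
case: (boolP (swap_set A \in X)) => //= sA; first exact/leqif_refl.
have jA : j \in A.
  apply: contraR sA => jA; rewrite swap_set_id //.
  by rewrite (negbTE iA) (negbTE jA).
suff lt : \sum_(x in swap_set A) (x : nat) < \sum_(x in A) (x : nat).
  by split; [exact: ltnW | rewrite ltn_eqF].
rewrite swap_set_move // big_setU1 ?inE ?(negbTE iA) ?andbF //= (big_setD1 j jA) /=.
by rewrite ltn_add2r.
Qed.

End Shift.

Definition shifted n (X : {set {set 'I_n}}) :=
  forall (i j : 'I_n) (A : {set 'I_n}),
    i < j -> A \in X -> j \in A -> i \notin A -> i |: (A :\ j) \in X.

Lemma shiftedVweight n (X : {set {set 'I_n}}) :
  shifted X \/ exists i j : 'I_n, i < j /\ weight (shift i j X) < weight X.
Proof.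
have [/existsP[i /existsP[j /andP[ltij w]]]|/existsPn noij] :=
    boolP [exists i : 'I_n, exists j : 'I_n, (i < j) && (weight (shift i j X) < weight X)].
  by right; exists i, j.
left=> i j A ltij AX jA iA.
move/existsPn: (noij i) => /(_ j); rewrite ltij /= -leqNgt.
rewrite (geq_leqif (weight_shift X ltij)) => /forall_inP/(_ A AX).
by rewrite iA swap_set_move.
Qed.

(** * Walks and shadows of cross-intersecting families *)

Section Ballot.

Variable n : nat.
Implicit Types (A B : {set 'I_n}) (X Y : {set {set 'I_n}}).

Definition prefix_card A (t : nat) := \sum_(x in A) (x < t).

Lemma prefix_cardE A t : prefix_card A t = \sum_(x < n) (x < t) * (x \in A).
Proof.
rewrite /prefix_card big_mkcond; apply: eq_bigr => x _.
by case: (x \in A); rewrite ?muln1 ?muln0.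
Qed.

Lemma prefix_card0 A : prefix_card A 0 = 0.
Proof. by rewrite /prefix_card big1. Qed.

Lemma prefix_cardS A (x : 'I_n) :
  prefix_card A x.+1 = prefix_card A x + (x \in A).
Proof.
rewrite !prefix_cardE (bigD1 x) //= [in RHS](bigD1 x) //= ltnSn ltnn mul1n.
rewrite mul0n add0n addnC; congr (_ + _); apply: eq_bigr => y yx.
by rewrite ltnS leq_eqVlt (inj_eq val_inj) (negbTE yx).
Qed.

Lemma prefix_cardD1 A (x : 'I_n) t :
  x \in A -> prefix_card A t = (x < t) + prefix_card (A :\ x) t.
Proof. by move=> xA; rewrite /prefix_card (big_setD1 x). Qed.

Lemma prefix_cardU1 A (x : 'I_n) t :
  x \notin A -> prefix_card (x |: A) t = (x < t) + prefix_card A t.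
Proof. by move=> xA; rewrite /prefix_card big_setU1. Qed.

Lemma sum_ltn_ord t : t <= n -> \sum_(x < n) (x < t) = t.
Proof.
move=> le_tn; rewrite -[RHS]card_ord -sum1_card (big_ord_widen n (fun=> 1)) //.
by rewrite [RHS]big_mkcond; apply: eq_bigr => x _; case: (x < t).
Qed.

(* The walk that steps up at [x \in A] and down at [x \notin A] never rises
   above its starting height. *)
Definition ballot A := forall t, t <= n -> 2 * prefix_card A t <= t.

(** Let [x] be the least common element. If [A] and [B] cover everything below [x], take [t = x.+1];
    otherwise shift [x] in [A] to an uncovered [y], which removes a common element, and induct. *)
Lemma shifted_cross_prefix X Y A B :
    shifted X -> cross_intersecting X Y -> A \in X -> B \in Y ->
  exists2 t, t <= n & t < prefix_card A t + prefix_card B t.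
Proof.
move=> shX cXY; have [m] := ubnP #|A :&: B|.
elim: m A => // m IHm A ltm AX BY.
have [x0 x0AB] := set0Pn _ (cXY A B AX BY).
case: (arg_minnP (fun x : 'I_n => x : nat) x0AB) => x /setIP[xA xB] xmin.
have AB1 (z : 'I_n) : z < x -> (z \in A) + (z \in B) <= 1.
  move=> zx; case: (boolP (z \in A)); case: (boolP (z \in B)) => // zB zA.
  by have /xmin : z \in A :&: B by [rewrite inE zA]; rewrite leqNgt zx.
have [/existsP[y /and3P[yx yA yB]]|/existsPn noy] :=
    boolP [exists y : 'I_n, [&& y < x, y \notin A & y \notin B]]; last first.
  exists x.+1 => //; rewrite !prefix_cardS xA xB.
  suff : x <= prefix_card A x + prefix_card B x by lia.
  rewrite -{1}(sum_ltn_ord (ltnW (ltn_ord x))) !prefix_cardE -big_split /=.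
  apply: leq_sum => z _; case: (ltnP z x) => //= zx.
  by have := noy z; rewrite zx /= negb_and !negbK; do 2 case: (_ \in _).
have y_neq_x : y != x by rewrite -(inj_eq val_inj) ltn_eqF.
have A'X := shX y x A yx AX xA yA.
have ltm' : #|(y |: A :\ x) :&: B| < m.
  have -> : (y |: A :\ x) :&: B = (A :&: B) :\ x.
    apply/setP=> z; rewrite !inE; case: (z =P y) => [->|_] /=.
      by rewrite (negbTE yB) !andbF.
    by rewrite andbA.
  by move: ltm; rewrite (cardsD1 x (A :&: B)) inE xA xB.
have [t le_tn] := IHm _ ltm' A'X BY.
rewrite prefix_cardU1 ?inE ?(negbTE yA) ?andbF // => ltt.
have EA := prefix_cardD1 t xA.
(* For [y < x < t] the exchange does not change the prefix count. *)
have [xt|tx] := ltnP x t; first by exists t => //; lia.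
(* Below the first common element [A], [B] and [{y}] are pairwise disjoint. *)
suff : (y < t) + prefix_card A t + prefix_card B t <= t by lia.
rewrite -{4}(sum_ltn_ord le_tn).
have -> : (y < t : nat) = \sum_(z < n) (z < t) * (z == y).
  rewrite (bigD1 y) //= eqxx muln1 big1 ?addn0 // => z /negbTE ->.
  by rewrite muln0.
rewrite !prefix_cardE -!big_split /=; apply: leq_sum => z _.
case: (ltnP z t) => //= zt; have := AB1 z (leq_trans zt tx).
case: (z =P y) => [->|_]; first by rewrite (negbTE yA) (negbTE yB).
by do 2 case: (_ \in _).
Qed.

(* [x] is the step at which the walk of [A] first reaches its maximum. *)
Definition first_peak A (x : 'I_n) := [&& x \in A,
  [forall s : 'I_n.+1, (s <= x) ==>
     (2 * prefix_card A s + x.+1 < 2 * prefix_card A x.+1 + s)] &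
  [forall s : 'I_n.+1, (x < s) ==>
     (2 * prefix_card A s + x.+1 <= 2 * prefix_card A x.+1 + s)]].

Lemma first_peak_exists A : ~ ballot A -> exists x, first_peak A x.
Proof.
move=> nbA.
pose P t := (t <= n) && [forall s : 'I_n.+1,
  2 * prefix_card A s + t <= 2 * prefix_card A t + s].
have exP : exists t, P t.
  (* This is the height of the walk plus [n], so that the subtraction is not truncated. *)
  case: (arg_maxnP (fun t : 'I_n.+1 => 2 * prefix_card A t + (n - t))
    (erefl : xpredT (ord0 : 'I_n.+1))) => t _ tmax.
  exists t; rewrite /P -ltnS ltn_ord; apply/forallP=> s.
  have := tmax s isT; have := ltn_ord s; have := ltn_ord t; lia.
case: (ex_minnP exP) => t /andP[le_tn /forallP tmax] tmin.
case: t le_tn tmax tmin => [|x] ltxn tmax tmin.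
  (* A maximum at time 0 would make [A] ballot. *)
  case: nbA => s le_sn; have := tmax (Ordinal (le_sn : s < n.+1)).
  by rewrite prefix_card0 /=; lia.
pose x' := Ordinal ltxn; have sE := prefix_cardS A x'; exists x'.
have lt_s (s : 'I_n.+1) : s <= x ->
    2 * prefix_card A s + x.+1 < 2 * prefix_card A x.+1 + s.
  move=> sx; rewrite ltnNge; apply/negP=> ge_s.
  have /tmin : P s; last by lia.
  rewrite /P -ltnS ltn_ord; apply/forallP=> r; have := tmax r; lia.
apply/and3P; split.
- have := lt_s (Ordinal (ltnW ltxn : x < n.+1)) (leqnn x).
  by rewrite /= sE /=; case: (x' \in A) => //; lia.
- by apply/forall_inP=> s; apply: lt_s.
- by apply/forall_inP=> s _; apply: tmax.
Qed.

(* In [A :\ x] the step [x] starts from the last maximum, so [x] is determined. *)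
Lemma first_peak_inj A B x y :
  first_peak A x -> first_peak B y -> A :\ x = B :\ y -> A = B.
Proof.
wlog le_xy : A B x y / x <= y.
  move=> IH pA pB E; case: (leqP x y) => [/IH|/ltnW/IH] H; first exact: H.
  by apply/esym/H.
move=> /and3P[xA _ /forall_inP hA] /and3P[yB /forall_inP hB _] E.
case: (ltngtP x y) le_xy => // [lt_xy _|/val_inj Exy _]; last first.
  by rewrite -(setD1K xA) E Exy setD1K.
have := hA (widen_ord (leqnSn n) y) lt_xy.
have := hB (widen_ord (leqnSn n) x) (ltnW lt_xy).
by rewrite /= !prefix_cardS xA yB !(prefix_cardD1 _ xA) !(prefix_cardD1 _ yB) E; lia.
Qed.

Lemma nonballot_card_shadow X :
  (forall A, A \in X -> ~ ballot A) -> #|X| <= #|shadow X|.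
Proof.
move=> nb; pose f A := if [pick x | first_peak A x] is Some x then A :\ x else A.
have fP A : A \in X -> exists2 x, first_peak A x & f A = A :\ x.
  move=> /nb/first_peak_exists[y yA]; rewrite /f; case: pickP => [x xA|/(_ y)].
    by exists x.
  by rewrite yA.
rewrite -(card_in_imset (f := f) (D := X)).
  apply/subset_leq_card/subsetP=> _ /imsetP[A AX ->].
  have [x /and3P[xA _ _] ->] := fP A AX.
  by apply/imset2P; exists A x.
move=> A B /fP[x pA ->] /fP[y pB ->]; exact: first_peak_inj pA pB.
Qed.

(** Only [X] is made shifted; [Y] is compressed along with it and its weight does not grow, so the
    total weight drops. *)
Lemma cross_intersecting_shadow X Y : cross_intersecting X Y ->
  #|X| <= #|shadow X| \/ #|Y| <= #|shadow Y|.
Proof.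
have [m] := ubnP (weight X + weight Y).
elim: m X Y => // m IHm X Y ltm cXY.
case: (shiftedVweight X) => [shX|[i [j [ltij ltw]]]]; last first.
  have shS Z : #|shadow (shift i j Z)| <= #|shadow Z|.
    by rewrite -(card_shift i j (shadow Z)) subset_leq_card ?shadow_shift.
  have [leY _] := weight_shift Y ltij.
  have lt' : weight (shift i j X) + weight (shift i j Y) < m by lia.
  have := IHm _ _ lt' (shift_cross cXY); rewrite !card_shift.
  by case=> le; [left | right]; apply: leq_trans le (shS _).
case: (boolP [exists A in X, [forall t : 'I_n.+1, 2 * prefix_card A t <= t]]).
  (* Ballot sets in both families would have prefix counts adding up to at most [t] for every
     [t]. *)
  case/exists_inP=> A AX /forallP bA; right; apply: nonballot_card_shadow => B BY bB.
  have [t le_tn] := shifted_cross_prefix shX cXY AX BY.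
  have := bA (Ordinal (le_tn : t < n.+1)); have := bB t le_tn; rewrite /=; lia.
move/exists_inPn=> nb; left; apply: nonballot_card_shadow => A /nb/forallPn[t].
by move=> /negP nbt bA; apply/nbt/bA; rewrite -ltnS.
Qed.

End Ballot.

(** * Fat slices *)

Section Fat.

Variable n : nat.
Implicit Types (U V E Z A : {set 'I_n}) (F G : {set {set 'I_n}}).

Definition slice U E F := [set A in F | A :\: U == E].

Definition shadow_in U F := [set A :\ x | A in F, x in A :&: U].

(* Intersecting with [U] identifies [slice U E F] with the family of the
   [C \subset U] such that [C :|: E \in F], and [shadow_in U] with its shadow. *)
Definition fat U F : {set {set 'I_n}} :=
  [set E | #|shadow_in U (slice U E F)| < #|slice U E F|].

Lemma shadow_in_setD U F A :
  A \in shadow_in U F -> exists2 B, B \in F & A :\: U = B :\: U.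
Proof.
case/imset2P=> B x BF; rewrite inE => /andP[_ xU] ->; exists B => //.
by apply/setP=> y; rewrite !inE; case: (y =P x) => [->|//]; rewrite xU.
Qed.

Lemma fat_witness U F E : E \in fat U F -> exists2 A, A \in F & A :\: U = E.
Proof.
rewrite inE => lt; have /card_gt0P[A] : 0 < #|slice U E F| by apply: leq_ltn_trans lt.
by rewrite inE => /andP[AF /eqP]; exists A.
Qed.

Lemma setI_inj_setD U E :
  {in [pred A : {set 'I_n} | A :\: U == E] &, injective (fun A => A :&: U)}.
Proof.
move=> A B /eqP EA /eqP EB EI.
by rewrite -(setID A U) -(setID B U) EA EB EI.
Qed.

Lemma fatE U F E :
  (E \in fat U F) =
  (#|shadow [set A :&: U | A in slice U E F]| < #|[set A :&: U | A in slice U E F]|).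
Proof.
rewrite inE.
have -> : shadow [set A :&: U | A in slice U E F] =
    [set A :&: U | A in shadow_in U (slice U E F)].
  apply/setP=> B; apply/imset2P/imsetP.
    case=> _ x /imsetP[A AF ->]; rewrite inE => /andP[xA xU] ->.
    exists (A :\ x); last by rewrite setIDAC.
    by apply/imset2P; exists A x; rewrite // inE xA xU.
  case=> _ /imset2P[A x AF xAU ->] ->.
  by exists (A :&: U) x; rewrite ?setIDAC //; apply/imsetP; exists A.
rewrite !card_in_imset //.
  by apply: (sub_in2 _ (@setI_inj_setD U E)) => A; rewrite inE => /andP[].
apply: (sub_in2 _ (@setI_inj_setD U E)) => A /shadow_in_setD[B].
by rewrite !inE => /andP[_ BE] ->.
Qed.

(** If [E] and [E'] were disjoint, members of their slices could meet only inside [U], so the two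
    trace families on [U] would be cross-intersecting and both fat. *)
Lemma fat_cross U F G :
  cross_intersecting F G -> cross_intersecting (fat U F) (fat U G).
Proof.
move=> cFG E E'; rewrite !fatE => fE fE'; apply/negP=> /eqP EE'0.
suff /cross_intersecting_shadow : cross_intersecting
    [set A :&: U | A in slice U E F] [set A :&: U | A in slice U E' G].
  by case; rewrite leqNgt ?fE ?fE'.
move=> _ _ /imsetP[A AF ->] /imsetP[B BG ->].
move: AF BG; rewrite !inE => /andP[AF /eqP EA] /andP[BG /eqP EB].
have /set0Pn[x] := cFG A B AF BG; rewrite inE => /andP[xA xB].
apply/set0Pn; exists x; rewrite !inE xA xB /= andbb.
move/setP/(_ x): EE'0; rewrite -EA -EB !inE xA xB !andbT.
by case: (x \in U).
Qed.

(* The slice of [V] and its shadow split according to the trace outside [U]. *)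
Lemma fat_refine U V F E :
  U \subset V -> E \in fat V F -> exists2 Z, Z \in fat U F & Z :\: V = E.
Proof.
move=> sUV fE.
have cardE (H : {set {set 'I_n}}) : #|H| = \sum_(Z : {set 'I_n}) #|[set A in H | A :\: U == Z]|.
  rewrite -sum1_card (partition_big (fun A => A :\: U) xpredT) //=.
  by apply: eq_bigr => Z _; rewrite -sum1_card; apply: eq_bigl => A; rewrite inE.
(* Otherwise summing over all [Z] would contradict the fatness of [E]. *)
have [Z ltZ] : exists Z, #|[set A in shadow_in V (slice V E F) | A :\: U == Z]| <
    #|[set A in slice V E F | A :\: U == Z]|.
  apply/existsP; apply: contraTT fE => /existsPn le; rewrite inE -leqNgt.
  by rewrite cardE [leqRHS]cardE; apply: leq_sum => Z _; rewrite leqNgt.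
have DUV A : A :\: U :\: V = A :\: V by rewrite setDDl (setUidPr sUV).
have ZV : Z :\: V = E.
  have /card_gt0P[A] : 0 < #|[set A in slice V E F | A :\: U == Z]|.
    exact: leq_ltn_trans ltZ.
  by rewrite !inE => /andP[/andP[_ /eqP <-] /eqP <-].
have sliceZ : [set A in slice V E F | A :\: U == Z] = slice U Z F.
  apply/setP=> A; rewrite !inE -andbA; congr (_ && _).
  by case: (eqVneq (A :\: U) Z) => [AZ|]; rewrite ?andbF // -DUV AZ ZV eqxx.
exists Z => //; rewrite inE -sliceZ; apply: leq_ltn_trans ltZ.
(* Deleting an element of [U] keeps the trace [Z], so [shadow_in U] of this part lies in the [Z]
   part of [shadow_in V]. *)
apply/subset_leq_card/subsetP=> A AS; rewrite inE; apply/andP; split.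
  case/imset2P: AS => B x; rewrite inE => /andP[BS _].
  rewrite inE => /andP[xB xU] ->; apply/imset2P; exists B x => //.
  by rewrite inE xB (subsetP sUV).
by have [B] := shadow_in_setD AS; rewrite !inE => /andP[_ BZ] ->.
Qed.

Lemma fat_link F (i : 'I_n) :
  #|shadow (link F i)| < #|link F i| -> [set i] \in fat [set~ i] F.
Proof.
rewrite fatE; suff -> : link F i = [set A :&: [set~ i] | A in slice [set~ i] [set i] F] by [].
have in_slice A : (A \in slice [set~ i] [set i] F) = (A \in F) && (i \in A).
  rewrite inE setDE setCK; congr (_ && _).
  by rewrite (sameP eqP setIidPr) sub1set.
by apply/setP=> B; apply/imsetP/imsetP=> -[A AF ->]; exists A;
   move: AF; rewrite ?in_slice ?inE // -?setDE.
Qed.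

End Fat.

Theorem theorem1p4 (n k l : nat) (F G : {set {set 'I_n}})
    (n_gt0 : 0 < n) (k_gt0 : 0 < k) (l_gt0 : 0 < l) (n_gt_kl : k * l < n)
    (F_unif : F \subset ksubsets 'I_n k) (G_unif : G \subset ksubsets 'I_n l)
    (FG_cross : cross_intersecting F G) :
  exists i : 'I_n,
    #|link F i| <= #|shadow (link F i)| \/ #|link G i| <= #|shadow (link G i)|.
Proof.
have [/existsP[i /orP]|/existsPn noi] := boolP [exists i : 'I_n,
    (#|link F i| <= #|shadow (link F i)|) || (#|link G i| <= #|shadow (link G i)|)].
  by exists i.
(* A fat link at [i] puts [[set i]] in [fat [set~ i] H]; refining from [[set~ i]] to [U] only adds
   elements other than [i]. *)
have fatI (H : {set {set 'I_n}}) (U : {set 'I_n}) (i : 'I_n) :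
    #|shadow (link H i)| < #|link H i| -> i \notin U ->
    exists2 E, E \in fat U H & i \in E.
  move=> /fat_link fi iU; have [|E fE Ei] := fat_refine (U := U) _ fi.
    by apply/subsetP=> x xU; rewrite !inE; apply: contraNneq iU => <-.
  by exists E => //; move/setP/(_ i): Ei; rewrite !inE eqxx.
have outU (U : {set 'I_n}) m : m <= k -> #|U| <= m * l -> exists i, i \notin U.
  move=> le_mk leU; apply/existsP; rewrite -negb_forall; apply/negP=> /forallP UT.
  suff : #|U| = n by nia.
  by rewrite -[RHS]card_ord; apply/eq_card=> i; rewrite UT.
(* Each absorbed [W \in fat U G] meets every member of [fat U F]. *)
have absorb m : m <= k -> exists2 U : {set 'I_n}, #|U| <= m * l &
    forall E, E \in fat U F -> #|E| + m <= k.
  elim: m => [|m IHm] le_mk.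
    exists set0 => [|E /fat_witness[A AF <-]]; first by rewrite cards0.
    by rewrite setD0 addn0; have := subsetP F_unif A AF; rewrite inE => /eqP ->.
  have [U leU sF] := IHm (ltnW le_mk).
  have [i iU] := outU U m (ltnW le_mk) leU.
  have /norP[_] := noi i; rewrite -ltnNge => /fatI/(_ iU)[W fW _].
  exists (U :|: W).
    apply: leq_trans (leq_card_setU _ _) _; rewrite mulSn addnC leq_add //.
    have [B BG <-] := fat_witness fW; have := subsetP G_unif B BG.
    by rewrite inE => /eqP <-; apply/subset_leq_card/subsetDl.
  move=> E fE; have [Z fZ ZE] := fat_refine (subsetUl U W) fE.
  have /set0Pn[x] := fat_cross FG_cross fZ fW; rewrite inE => /andP[xZ xW].
  (* [E] is [Z] without [U :|: W], hence loses [x], which lies in [W]. *)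
  have : E \subset Z :\ x.
    rewrite -ZE; apply/subsetP=> y; rewrite !inE negb_or -andbA => /and3P[_ yW ->].
    by rewrite andbT; apply: contraNneq yW => ->.
  move=> /subset_leq_card; have := sF Z fZ; rewrite (cardsD1 x Z) xZ; lia.
(* Now [fat U F] has at most the empty member, yet [fatI] produces one containing [i]. *)
have [U leU sF] := absorb k (leqnn k).
have [i iU] := outU U k (leqnn k) leU.
have /norP[] := noi i; rewrite -ltnNge => /fatI/(_ iU)[E fE iE] _.
have := sF E fE; rewrite (cardsD1 i E) iE; lia.
Qed.
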